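(* Let $\mathcal{A},\mathcal{B}\subseteq\mathcal{P}_\infty(\mathbb{N})$ be hereditary families with $\mathcal{A}\perp\mathcal{B}$. Assume $\mathcal{A}$ is analytic and $\mathcal{B}$ is $C$-measurable and an M-family. Then either (i) $\mathcal{A}$ is countably generated in $\mathcal{B}^\perp$, or (ii) there exists a one-to-one map $\psi:\mathbb{N}^{<\mathbb{N}}\to\mathbb{N}$ such that $\mathcal{C}\subseteq\{\psi^{-1}(A):A\in\mathcal{A}\}$ and $\mathcal{I}_{\mathrm{wf}}\subseteq\{\psi^{-1}(B):B\in\mathcal{B}^{\perp\perp}\}$.
   Context: $\mathcal{P}_\infty(X)$: infinite subsets of countable $X$, with the topology of $2^X$. $C$-measurable: in the smallest $\sigma$-algebra containing open sets and closed under the Souslin operation. Hereditary: closed under passing to infinite subsets. An M-family is a hereditary family $\mathcal{A}$ such that for every sequence $(A_n)_n$ in $\mathcal{A}$ there is $A\in\mathcal{A}$ with $A\setminus\bigcup_{i\ge n}A_i$ finite for every $n$. $A\perp B$ means $A\cap B$ finite; $\mathcal{A}\perp\mathcal{B}$ means pairwise; $\mathcal{A}^\perp=\{B\in\mathcal{P}_\infty(X):B\perp A\ \forall A\in\mathcal{A}\}$, $\mathcal{B}^{\perp\perp}=(\mathcal{B}^\perp)^\perp$. $\mathcal{A}$ is countably generated in $\mathcal{D}$ if there are $D_n\in\mathcal{D}$ with every $A\in\mathcal{A}$ satisfying $A\setminus D_n$ finite for some $n$. $\mathbb{N}^{<\mathbb{N}}$ is the tree of finite sequences of naturals ordered by end-extension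 $\sqsubset$. $\mathcal{C}$ is the family of infinite chains of $\mathbb{N}^{<\mathbb{N}}$ (infinite subsets linearly ordered by $\sqsubset$). $\mathrm{WF}$ is the set of downwards closed, well-founded (no infinite branch), infinite subtrees of $\mathbb{N}^{<\mathbb{N}}$, and $\mathcal{I}_{\mathrm{wf}}=\{W\in\mathcal{P}_\infty(\mathbb{N}^{<\mathbb{N}}):\exists T\in\mathrm{WF},\ W\subseteq T\}$. *)

(* Defs.v *)
From Stdlib Require Import List Arith.
Import ListNotations.

Definition nset := nat -> Prop.
Definition family := nset -> Prop.

Definition ninfinite (A : nset) : Prop := forall N, exists k, N <= k /\ A k.
Definition nfinite (A : nset) : Prop := exists N, forall k, A k -> k < N.

Definition in_Pinf (F : family) : Prop := forall A, F A -> ninfinite A.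

Definition agree_upto (n : nat) (x y : nset) : Prop :=
  forall k, k < n -> (x k <-> y k).
Definition open2N (U : family) : Prop :=
  forall x, U x -> exists n, forall y, agree_upto n x y -> U y.

Definition continuous_BC (g : (nat -> nat) -> nset) : Prop :=
  forall (f : nat -> nat) (n : nat), exists m, forall f' : nat -> nat,
    (forall k, k < m -> f' k = f k) -> agree_upto n (g f') (g f).

Definition analytic (F : family) : Prop :=
  (forall x, ~ F x) \/
  exists g, continuous_BC g /\
    forall x, F x <-> exists f, forall k, (g f k <-> x k).

Definition prefix (f : nat -> nat) (n : nat) : list nat := map f (seq 0 n).

Definition souslin (S : list nat -> family) : family :=
  fun x => exists f : nat -> nat, forall n, S (prefix f (n + 1)) x.

Definition Cmeasurable (F : family) : Prop :=
  forall M : family -> Prop,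
    (forall U, open2N U -> M U) ->
    (forall U, M U -> M (fun x => ~ U x)) ->
    (forall Us : nat -> family, (forall n, M (Us n)) ->
        M (fun x => exists n, Us n x)) ->
    (forall S : list nat -> family, (forall s, M (S s)) -> M (souslin S)) ->
    M F.

Definition subset (A B : nset) : Prop := forall k, A k -> B k.

Definition hereditary (F : family) : Prop :=
  in_Pinf F /\ forall A B, F A -> ninfinite B -> subset B A -> F B.

Definition almost_sub (A B : nset) : Prop := nfinite (fun k => A k /\ ~ B k).

Definition Mfamily (F : family) : Prop :=
  hereditary F /\
  forall As : nat -> nset, (forall n, F (As n)) ->
    exists A, F A /\ forall n, almost_sub A (fun k => exists i, n <= i /\ As i k).

Definition perp (A B : nset) : Prop := nfinite (fun k => A k /\ B k).
Definition fperp (F G : family) : Prop := forall A B, F A -> G B -> perp A B.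
Definition perpf (F : family) : family :=
  fun B => ninfinite B /\ forall A, F A -> perp B A.

Definition ctbl_generated_in (F D : family) : Prop :=
  exists Ds : nat -> nset, forall A, F A -> exists n, D (Ds n) /\ almost_sub A (Ds n).

Definition tset := list nat -> Prop.
Definition tfinite (W : tset) : Prop := exists l : list (list nat), forall s, W s -> In s l.
Definition tinfinite (W : tset) : Prop := ~ tfinite W.
Definition endext (s t : list nat) : Prop := exists u, t = s ++ u.

Definition chainsC (C : tset) : Prop :=
  tinfinite C /\ forall s t, C s -> C t -> endext s t \/ endext t s.

Definition WF (T : tset) : Prop :=
  (forall s t, T s -> endext t s -> T t) /\
  (~ exists f : nat -> nat, forall n, T (prefix f n)) /\
  tinfinite T.

Definition Iwf (W : tset) : Prop :=
  tinfinite W /\ exists T, WF T /\ forall s, W s -> T s.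

Definition preimages (psi : list nat -> nat) (F : family) : tset -> Prop :=
  fun W => exists A, F A /\ forall s, W s <-> A (psi s).

(* Main.v *)
(** Call [X] positive when the members of [A] contained in [X] are not countably generated in
    [B]^perp. If (i) fails, the positive sets form a proper coideal, and each of them contains a
    member of [B]. Mathias-Ellentuck neighbourhoods built from decreasing sequences of positive
    sets admit fusion, so every C-measurable family is Ramsey for them. Applied to [B], and
    combined with the M-property, this gives inside every positive set a decreasing sequence
    [X_n] of positive sets such that every infinite set almost contained in all [X_n] contains
    a member of [B]. Using such a sequence at every node [t], choose [psi (t^i)] and all its
    descendants inside [X_i], while determining one more coordinate of a point of Baire space
    whose image in [A] (by analyticity) contains the branch so far. Branches then land in [A].
    An infinite subset of a well-founded tree has, by Koenig's lemma, infinitely many elements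
    above some [t] but only finitely many above each [t^i]; its image above [t] is almost
    contained in all [X_n], hence contains a member of [B]. *)

Require Import Defs.
From Stdlib Require Import List Arith.
From Stdlib Require Import Lia Classical IndefiniteDescription Cantor.
Import ListNotations.

(** * Dependent choice and course-of-values recursion *)

Lemma dependent_choice_inv {T : Type} (I : T -> Prop) (step : nat -> T -> T -> Prop) (x0 : T) :
  I x0 -> (forall n x, I x -> exists y, I y /\ step n x y) ->
  exists f : nat -> T, f 0 = x0 /\ forall n, I (f n) /\ step n (f n) (f (S n)).
Proof.
  intros H0 Hs.
  destruct (functional_choice (fun (p : nat * T) y => I (snd p) -> I y /\ step (fst p) (snd p) y)) as [c Hc].
  { intros [n x]; simpl. destruct (classic (I x)) as [H|H].
    - destruct (Hs n x H) as [y Hy]. exists y; auto.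
    - exists x; tauto. }
  set (f := fix f n := match n with 0 => x0 | S n => c (n, f n) end).
  assert (HI : forall n, I (f n)).
  { induction n; simpl; auto. apply (Hc (n, f n)); auto. }
  exists f; split; [reflexivity|]. intro n; split; [apply HI|].
  apply (Hc (n, f n)); apply HI.
Qed.

(** Dependent choice on finite approximations [(n, h)], followed by the diagonal. The first
    hypothesis says that [R n] reads its history only below [n], so later changes do no harm. *)
Lemma strong_choice {T : Type} (s0 : T) (R : nat -> (nat -> T) -> T -> Prop) :
  (forall n h h' x, (forall m, m < n -> h m = h' m) -> R n h x -> R n h' x) ->
  (forall n h, (forall m, m < n -> R m h (h m)) -> exists x, R n h x) ->
  exists F, forall n, R n F (F n).
Proof.
  intros Hext Htot.
  destruct (dependent_choice_inv
    (fun p : nat * (nat -> T) => forall m, m < fst p -> R m (snd p) (snd p m))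
    (fun _ p q => fst q = 1 + fst p /\ forall m, m < fst p -> snd q m = snd p m)
    (0, fun _ => s0)) as [f [H0 Hf]].
  - simpl; intros; lia.
  - intros _ [n h] H; simpl in *. destruct (Htot n h H) as [x Hx].
    exists (1 + n, fun m => if m =? n then x else h m); simpl.
    assert (E : forall m, m < n -> (if m =? n then x else h m) = h m).
    { intros m Hm. destruct (Nat.eqb_spec m n); [lia|reflexivity]. }
    split; [|auto]. intros m Hm.
    destruct (Nat.eqb_spec m n) as [->|Hne].
    + apply Hext with h; auto. intros; symmetry; auto.
    + apply Hext with h; [intros; symmetry; apply E; lia|]. apply H; lia.
  - assert (L : forall n, fst (f n) = n).
    { induction n; [rewrite H0; reflexivity|]. destruct (Hf n) as [_ [E _]]. lia. }
    assert (St : forall d n m, m < n -> snd (f (d + n)) m = snd (f n) m).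
    { induction d; intros; simpl; auto.
      destruct (Hf (d + n)) as [_ [_ E]]. rewrite E; [auto|rewrite L; lia]. }
    exists (fun n => snd (f (1 + n)) n). intro n.
    apply Hext with (snd (f (1 + n))).
    + intros m Hm. replace (1 + n) with ((n - m) + (1 + m)) by lia. apply St; lia.
    + apply (Hf (1 + n)). rewrite L; lia.
Qed.

(** * Infinite sets of naturals *)

Lemma not_nfinite (X : nset) : ~ nfinite X -> ninfinite X.
Proof.
  intros H N. apply NNPP; intro C. apply H. exists N. intros k Hk.
  destruct (Nat.lt_ge_cases k N); auto. destruct C; eauto.
Qed.

Lemma ninfinite_not_nfinite (X : nset) : ninfinite X -> ~ nfinite X.
Proof. intros H [N HN]. destruct (H N) as [k [Hk Xk]]. apply HN in Xk. lia. Qed.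

Lemma ninfinite_subset (X Y : nset) : subset X Y -> ninfinite X -> ninfinite Y.
Proof. intros S H N. destruct (H N) as [k [? ?]]. eauto. Qed.

Lemma ninfinite_almost_sub (X Y : nset) :
  ninfinite X -> almost_sub X Y -> ninfinite (fun k => X k /\ Y k).
Proof.
  intros H [N HN] M. destruct (H (N + M)) as [k [Hk Xk]].
  exists k; repeat split; [lia|auto|]. apply NNPP; intro C.
  assert (k < N) by auto. lia.
Qed.

Lemma least_from (X : nset) (m : nat) :
  ninfinite X -> exists k, m <= k /\ X k /\ forall j, m <= j < k -> ~ X j.
Proof.
  intro H. destruct (H m) as [k0 Hk0]. revert Hk0.
  induction k0 as [k IH] using lt_wf_ind; intros [Hm Hk].
  destruct (classic (exists j, m <= j < k /\ X j)) as [[j [Hj Xj]]|C].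
  - apply (IH j); [lia|split; [lia|auto]].
  - exists k; repeat split; auto. intros j Hj Xj; apply C; eauto.
Qed.

(** * Ellentuck theory for decreasing sequences of positive sets *)

(* [cut n A m]: [m] is [n], or the successor of an element of [A] above [n]. *)
Inductive cut (n : nat) (A : nset) : nat -> Prop :=
| cut_base : cut n A n
| cut_step m k : cut n A m -> m <= k -> A k -> (forall j, m <= j < k -> ~ A j) -> cut n A (S k).

Lemma cut_le n A m : cut n A m -> n <= m.
Proof. induction 1; lia. Qed.

Lemma cut_trans n A m j : cut n A m -> cut m A j -> cut n A j.
Proof. intros H; induction 1; auto. eapply cut_step; eauto. Qed.

Lemma cut_agree n A A' m : cut n A m -> agree_upto m A A' -> cut n A' m.
Proof.
  unfold agree_upto. induction 1 as [|m k H IH Hk Ak Hl]; intro E; [constructor|].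
  apply cut_step with m; auto.
  - apply IH. intros; apply E; lia.
  - apply E; auto.
  - intros j Hj Aj. apply (Hl j Hj). apply E; [lia|auto].
Qed.

Lemma cut_unbounded n A N : ninfinite A -> exists m, N <= m /\ cut n A m.
Proof.
  intro H. induction N as [|N [m [Hm Cm]]].
  - exists n; split; [lia|constructor].
  - destruct (least_from A m H) as [k [Hk [Ak Hl]]].
    exists (S k); split; [lia|]. eapply cut_step; eauto.
Qed.

(* The basic Ellentuck set [[a | n, X]]: the next element after a cut [m] is taken from [X m]. *)
Definition basic (a : nset) (n : nat) (X : nat -> nset) (A : nset) : Prop :=
  ninfinite A /\ agree_upto n a A /\
  forall m k, cut n A m -> A k -> m <= k -> X m k.

Lemma basic_cut a n X A m : basic a n X A -> cut n A m -> basic A m X A.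
Proof.
  intros [H1 [H2 H3]] C. split; [auto|split].
  - intros j _; tauto.
  - intros j k Hj. apply H3. eapply cut_trans; eauto.
Qed.

Lemma basic_agree a b n X A : agree_upto n a b -> basic a n X A -> basic b n X A.
Proof.
  intros E [H1 [H2 H3]]. split; [auto|split; auto].
  intros j Hj. rewrite <- (E j Hj). apply H2; auto.
Qed.

Lemma basic_mono a n X Y A :
  (forall m, n <= m -> subset (X m) (Y m)) -> basic a n X A -> basic a n Y A.
Proof.
  intros E [H1 [H2 H3]]. split; [auto|split; auto].
  intros m k C Ak Hk. apply E; [eapply cut_le; eauto|]. apply H3; auto.
Qed.

Lemma basic_inhabited (P : nset) b m X :
  (forall i i', i <= i' -> subset (X i') (X i)) ->
  (forall j, ninfinite (fun k => X j k /\ P k)) ->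
  exists A, basic b m X A /\ forall k, m <= k -> A k -> P k.
Proof.
  intros Dec H.
  destruct (functional_choice (fun c k => c <= k /\ X c k /\ P k)) as [K HK].
  { intro c. destruct (H c c) as [k Hk]. exists k; tauto. }
  (* Greedy construction: [c i] runs through the cuts of the set from [m] on, and [K (c i)] is the
     element of [P] picked right after the cut [c i]. *)
  set (c := fix c i := match i with 0 => m | S i => S (K (c i)) end).
  assert (Mon : forall i j, i <= j -> c i <= c j).
  { intros i j; induction 1; simpl; [lia|]. destruct (HK (c m0)). lia. }
  assert (Mon' : forall i j, i < j -> K (c i) < c j).
  { intros i j Hij. apply (Mon (S i) j) in Hij. simpl in Hij. lia. }
  set (A := fun k => (k < m /\ b k) \/ exists i, k = K (c i)).
  assert (Ainv : forall k, m <= k -> A k -> exists i, k = K (c i)).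
  { intros k Hk [[? ?]|?]; [lia|auto]. }
  assert (Hcm : forall i, m <= c i) by (intro i; apply (Mon 0 i); lia).
  exists A. split; [split; [|split]|].
  - intro N. exists (K (c N)). split; [|right; eauto].
    assert (N <= c N).
    { induction N as [|N IHN]; simpl; [lia|]. destruct (HK (c N)). lia. }
    destruct (HK (c N)). lia.
  - intros k Hk. split; [left; auto|]. intros [[_ ?]|[i ->]]; auto.
    destruct (HK (c i)); specialize (Hcm i); lia.
  - intros d k Cd Ak Hk.
    assert (exists i, d = c i) as [i ->].
    { destruct Cd as [|d k' Cd' Hd Ak' _]; [exists 0; auto|].
      destruct (Nat.le_gt_cases m k') as [L|L].
      - destruct (Ainv k' L Ak') as [i ->]. exists (S i); auto.
      - apply cut_le in Cd'. lia. }
    destruct (Ainv k) as [j ->]; [specialize (Hcm i); lia|auto|].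
    destruct (Nat.le_gt_cases i j) as [L|L].
    + apply (Dec _ (c j)); auto. apply HK.
    + apply Mon' in L. lia.
  - intros k Hk Ak. destruct (Ainv k Hk Ak) as [i ->]. apply HK.
Qed.

(** * Coideals and fusion of decreasing sequences *)

Record coideal (pos : nset -> Prop) : Prop := {
  coideal_mono : forall X Y, subset X Y -> pos X -> pos Y;
  coideal_split : forall X P : nset,
    pos X -> pos (fun k => X k /\ P k) \/ pos (fun k => X k /\ ~ P k);
  coideal_inf : forall X, pos X -> ninfinite X }.

Definition decr (pos : nset -> Prop) (X : nat -> nset) : Prop :=
  (forall i j, i <= j -> subset (X j) (X i)) /\ forall i, pos (X i).

Definition refines (Y X : nat -> nset) : Prop := forall m, subset (Y m) (X m).

Lemma refines_refl X : refines X X.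
Proof. intros m k; auto. Qed.

Lemma refines_trans X Y Z : refines X Y -> refines Y Z -> refines X Z.
Proof. intros H K m k h. apply K, H, h. Qed.

Lemma finite_meet {T : Type} pos (Q : T -> (nat -> nset) -> Prop) X (l : list T) :
  decr pos X ->
  (forall t Y Z, refines Z Y -> Q t Y -> Q t Z) ->
  (forall t Y, decr pos Y -> refines Y X -> exists Z, decr pos Z /\ refines Z Y /\ Q t Z) ->
  exists Z, decr pos Z /\ refines Z X /\ forall t, In t l -> Q t Z.
Proof.
  intros HX Her Den. induction l as [|t l [Z [HZ [RZ IH]]]].
  - exists X. repeat split; try apply HX; [apply refines_refl|intros _ []].
  - destruct (Den t Z HZ RZ) as [W [HW [RW QW]]]. exists W.
    split; [auto|split; [eapply refines_trans; eauto|]].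
    intros u [->|Hu]; auto. apply Her with Z; auto.
Qed.

(** These are the subsets of the first [m] naturals. Since there are finitely many, one stage of a
    fusion can treat all stems of length [m]. *)
Fixpoint stems (m : nat) : list nset :=
  match m with
  | 0 => [fun _ => False]
  | S m => map (fun (b : nset) k => b k \/ k = m) (stems m) ++ stems m
  end.

Lemma stems_spec m (b : nset) : exists b', In b' (stems m) /\ agree_upto m b' b.
Proof.
  assert (exists b', In b' (stems m) /\ agree_upto m b' b /\ forall k, m <= k -> ~ b' k)
    as [b' [? [? _]]]; [|eauto].
  induction m as [|m [b' [I [E O]]]].
  - exists (fun _ => False). simpl. split; [auto|split; [|tauto]]. intros k Hk; lia.
  - destruct (classic (b m)) as [Hb|Hb].
    + exists (fun k => b' k \/ k = m). split; [|split].
      * simpl. apply in_or_app; left. apply in_map with (f := fun (b : nset) k => b k \/ k = m); auto.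
      * intros k Hk. destruct (Nat.eq_dec k m) as [->|]; [tauto|].
        rewrite (E k); [|lia]. intuition lia.
      * intros k Hk [Hbk| ->]; [|lia]. apply (O k); [lia|auto].
    + exists b'. split; [|split].
      * simpl. apply in_or_app; auto.
      * intros k Hk. destruct (Nat.eq_dec k m) as [->|]; [|apply E; lia].
        split; [|tauto]. intro h. destruct (O m); auto.
      * intros k Hk. apply O; lia.
Qed.

(** Stage [m] meets the requirements [Q i m b] for all [i <= m] and all stems [b], and changes only
    entries from [m] on. Entry [j] is thus final after stage [j]. The limit keeps every requirement
    because [Q i m b] looks only at entries from [m] on and is hereditary. *)
Lemma fusion pos (Q : nat -> nat -> nset -> (nat -> nset) -> Prop) X :
  decr pos X ->
  (forall i m b b' Y, agree_upto m b b' -> Q i m b Y -> Q i m b' Y) ->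
  (forall i m b Y Z, (forall j, m <= j -> subset (Z j) (Y j)) -> Q i m b Y -> Q i m b Z) ->
  (forall i m b Y, decr pos Y -> refines Y X ->
     exists Z, decr pos Z /\ refines Z Y /\ Q i m b Z) ->
  exists Y, decr pos Y /\ refines Y X /\ forall i m b, i <= m -> Q i m b Y.
Proof.
  intros HX Ext Her Den.
  destruct (dependent_choice_inv (fun Y => decr pos Y /\ refines Y X)
    (fun m Y Z => refines Z Y /\ (forall j, j < m -> Z j = Y j) /\
       forall i b, i <= m -> Q i m b Z) X) as [f [H0 Hf]].
  - split; [auto|apply refines_refl].
  - intros m Y [HY RY].
    destruct (finite_meet pos (fun t => Q (fst t) m (snd t)) Y
      (list_prod (seq 0 (S m)) (stems m))) as [Z [HZ [RZ QZ]]]; auto.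
    { intros [i b] Y' Z' R; simpl. apply Her. intros; apply R. }
    { intros [i b] Y' HY' RY'; simpl. apply Den; auto. eapply refines_trans; eauto. }
    (* Entries below [m] are frozen. The sequence still decreases, since [Z] refines [Y]. *)
    set (Z' := fun j => if j <? m then Y j else Z j).
    assert (R : refines Z' Y).
    { intro j. unfold Z'. destruct (j <? m); [intros k; auto|apply RZ]. }
    exists Z'. split; [split|split; [|split]]; auto.
    + destruct HY as [DY PY], HZ as [DZ PZ]. split.
      * intros i j Hij. unfold Z'.
        destruct (Nat.ltb_spec j m), (Nat.ltb_spec i m); try lia; auto.
        intros k Hk. apply (DY i j Hij). apply RZ; auto.
      * intro i. unfold Z'. destruct (i <? m); auto.
    + eapply refines_trans; eauto.
    + intros j Hj. unfold Z'. destruct (Nat.ltb_spec j m); [auto|lia].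
    + intros i b Hi. destruct (stems_spec m b) as [b' [I E]].
      apply Ext with b'; auto. apply Her with Z.
      * intros j Hj. unfold Z'. destruct (Nat.ltb_spec j m); [lia|intro; auto].
      * apply (QZ (i, b')). apply in_prod; auto. apply in_seq; lia.
  - assert (Rf : forall n d, refines (f (d + n)) (f n)).
    { induction d; [apply refines_refl|]. simpl.
      eapply refines_trans; [|exact IHd]. apply Hf. }
    assert (Ef : forall j d, f (d + S j) j = f (S j) j).
    { induction d; auto. simpl. rewrite <- IHd. apply Hf. lia. }
    exists (fun j => f (S j) j). split; [split|split].
    + intros i j Hij. rewrite <- (Ef i (j - i)).
      replace (j - i + S i) with (S j) by lia. apply (Hf (S j)); auto.
    + intro i. apply (Hf (S i)).
    + intros j. apply (Hf (S j)).
    + intros i m b Hi. apply Her with (f (S m)); [|apply Hf; auto].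
      intros j Hj. replace (S j) with ((j - m) + S m) by lia. apply Rf.
Qed.

(** * The Ramsey property and its closure properties *)

Definition disjoint_on (a : nset) n X (F : family) : Prop := forall A, basic a n X A -> ~ F A.
Definition included_on (a : nset) n X (F : family) : Prop := forall A, basic a n X A -> F A.

(** The analogue of completely Ramsey sets, with decreasing sequences of positive sets in place of
    infinite sets. *)
Definition Ramsey (pos : nset -> Prop) (F : family) : Prop :=
  forall a n X, decr pos X -> exists Y, decr pos Y /\ refines Y X /\
    (included_on a n Y F \/ disjoint_on a n Y F).

Lemma refines_basic a n Y X A : refines Y X -> basic a n Y A -> basic a n X A.
Proof. intros R. apply basic_mono. intros; apply R. Qed.

Lemma included_agree a b n X F : agree_upto n a b -> included_on a n X F -> included_on b n X F.
Proof.
  intros E I A BA. apply I. eapply basic_agree; [|eauto]. intros k Hk; symmetry; auto.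
Qed.

Lemma included_mono a n X Y F :
  (forall j, n <= j -> subset (Y j) (X j)) -> included_on a n X F -> included_on a n Y F.
Proof. intros S I A BA. apply I. eapply basic_mono; eauto. Qed.

Lemma decide_included pos (Fs : nat -> family) X :
  decr pos X ->
  exists Y, decr pos Y /\ refines Y X /\ forall i m b, i <= m ->
    included_on b m Y (Fs i) \/
    forall Z, decr pos Z -> refines Z Y -> ~ included_on b m Z (Fs i).
Proof.
  intros HX.
  (* Rejection is strengthened to all [Z] that lie inside [Y] from [m] on, as fusion asks for a
     property of these entries alone. *)
  destruct (fusion pos (fun i m b Y => included_on b m Y (Fs i) \/
     forall Z, decr pos Z -> (forall j, m <= j -> subset (Z j) (Y j)) ->
       ~ included_on b m Z (Fs i)) X)
    as [Y [HY [RY QY]]]; auto.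
  { intros i m b b' Y E [H|H]; [left|right].
    - eapply included_agree; eauto.
    - intros Z HZ SZ I. apply (H Z HZ SZ). eapply included_agree; [|eauto].
      intros k Hk; symmetry; auto. }
  { intros i m b Y Z S [H|H]; [left|right].
    - eapply included_mono; eauto.
    - intros W HW SW. apply H; auto. intros j Hj k Hk. apply S; auto. apply SW; auto. }
  { intros i m b Y HY RY.
    destruct (classic (exists Z, decr pos Z /\ (forall j, m <= j -> subset (Z j) (Y j)) /\
       included_on b m Z (Fs i))) as [[Z [HZ [SZ I]]]|C].
    (* Below [m] the entries of [Z] are uncontrolled; replacing them by [Z m] gives a refinement of
       [Y]. *)
    - exists (fun j => Z (max j m)). split; [split|split].
      + intros j j' Hj. apply HZ. lia.
      + intro; apply HZ.
      + intros j k Hk. destruct HY as [DY _]. apply (DY j (max j m)); [lia|].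
        apply SZ; [lia|auto].
      + left. eapply included_mono; [|eauto].
        intros j Hj. simpl. replace (max j m) with j by lia. intro; auto.
    - exists Y. split; [auto|split; [apply refines_refl|right]].
      intros Z HZ SZ I. apply C; eauto. }
  exists Y. split; [auto|split; [auto|]]. intros i m b Hi.
  destruct (QY i m b Hi) as [H|H]; [auto|right]. intros Z HZ RZ. apply H; auto.
Qed.

(* Combinatorial forcing: either [Y] accepts [F], or all stems along members of [Y] reject it. *)
Lemma accept_or_reject pos (F : family) a n X :
  coideal pos -> decr pos X ->
  exists Y, decr pos Y /\ refines Y X /\
    (included_on a n Y F \/
     forall A m, basic a n Y A -> cut n A m -> ~ included_on A m Y F).
Proof.
  intros Hpos HX.
  destruct (decide_included pos (fun _ => F) X HX) as [X1 [H1 [R1 D1]]].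
  assert (D := fun m b => D1 0 m b (Nat.le_0_l m)). clear D1.
  (* The stem [b] below [m], extended by the single next element [k]. *)
  set (ext := fun (b : nset) (m k j : nat) => (j < m /\ b j) \/ j = k).
  destruct (fusion pos (fun _ m b Y => included_on b m X1 F \/
     forall k, m <= k -> Y m k -> ~ included_on (ext b m k) (S k) X1 F) X1)
    as [Y [HY [RY QY]]]; auto.
  { assert (Ag : forall m b b' k i, agree_upto m b b' -> agree_upto i (ext b m k) (ext b' m k)).
    { intros m b b' k i E j _. unfold ext. split; (intros [[L h]|]; [left|auto]);
      split; auto; apply E; auto. }
    intros _ m b b' Z E [H|H]; [left|right].
    - eapply included_agree; eauto.
    - intros k Hk Zk I. apply (H k Hk Zk). eapply included_agree; [|eauto].
      apply Ag. intros i Hi; symmetry; auto. }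
  { intros _ m b Z W S [H|H]; [auto|right].
    intros k Hk Wk. apply H; auto. apply (S m); auto. }
  { intros _ m b Z HZ RZ.
    destruct (D m b) as [|Rej].
    { exists Z. split; [auto|split; [apply refines_refl|auto]]. }
    (* If all [Z j] meet [Acc] in a positive set, these intersections form a sequence that accepts
       [b], against rejection. Otherwise [Acc] can be removed from a tail of [Z], and every
       one-element extension is rejected. *)
    set (Acc := fun k => m <= k /\ included_on (ext b m k) (S k) X1 F).
    destruct (classic (forall j, pos (fun k => Z j k /\ Acc k))) as [P|P].
    - exfalso. apply (Rej (fun j k => Z j k /\ Acc k)).
      + split; auto. intros i j Hij k [Hk Ak]. split; auto. apply (proj1 HZ i j); auto.
      + intros j k [Hk _]. apply RZ; auto.
      + intros A BA. assert (BA' := BA). destruct BA' as [IA [EA CA]].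
        destruct (least_from A m IA) as [k [Hk [Ak Hl]]].
        destruct (CA m k (cut_base _ _) Ak Hk) as [_ [_ HI]]. apply HI.
        apply basic_agree with A; [|].
        * intros j Hj. unfold ext. split.
          -- intro Aj. destruct (Nat.lt_ge_cases j m); [left; split; [auto|apply EA; auto]|right].
             destruct (Nat.eq_dec j k); auto. exfalso. apply (Hl j); [lia|auto].
          -- intros [[L h]| ->]; auto. apply EA; auto.
        * apply basic_cut with b m.
          -- apply refines_basic with (fun j k => Z j k /\ Acc k); auto.
             intros j i [Hi _]. apply RZ; auto.
          -- eapply cut_step; eauto. constructor.
    - apply not_all_ex_not in P. destruct P as [j0 P].
      exists (fun j k => Z (max j j0) k /\ ~ Acc k). split; [split|split].
      + intros i j Hij k [Hk Ak]. split; auto.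
        apply (proj1 HZ (max i j0) (max j j0)); auto; lia.
      + intro i. destruct (coideal_split pos Hpos (Z (max i j0)) Acc) as [C|C]; auto.
        * apply HZ.
        * destruct P. eapply coideal_mono; [exact Hpos| |exact C].
          intros k [Hk Ak]. split; auto. apply (proj1 HZ j0 (max i j0)); auto; lia.
      + intros j k [Hk _]. apply (proj1 HZ j (max j j0)); auto; lia.
      + right. intros k Hk [_ NA] I. apply NA. split; auto. }
  exists Y. split; [auto|split; [eapply refines_trans; eauto|]].
  destruct (classic (included_on a n X1 F)) as [Acc|Rej].
  { left. intros A BA. apply Acc. eapply refines_basic; eauto. }
  right. intros A m BA Cm.
  (* Rejection passes from each cut of [A] to the next, by the choice of [Y]. *)
  assert (~ included_on A m X1 F) as RejA.
  { induction Cm as [|m k Cm IH Hk Ak Hl].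
    - intro I. apply Rej. intros A' BA'. apply I. eapply basic_agree; [|eauto]. apply BA.
    - destruct (QY 0 m A) as [H|H]; [lia|tauto|].
      intro I. apply (H k Hk); [apply BA; auto|].
      intros A' BA'. apply I. eapply basic_agree; [|eauto].
      intros j Hj. unfold ext. split.
      + intros [[_ h]| ->]; auto.
      + intro Aj. destruct (Nat.lt_ge_cases j m); [left; auto|right].
        destruct (Nat.eq_dec j k); auto. exfalso. apply (Hl j); [lia|auto]. }
  destruct (D m A) as [|H]; [tauto|]. apply H; auto.
Qed.

Lemma Ramsey_ext pos (F G : family) : (forall A, F A <-> G A) -> Ramsey pos F -> Ramsey pos G.
Proof.
  intros E H a n X HX. destruct (H a n X HX) as [Y [HY [RY I]]].
  exists Y; split; [auto|split; [auto|]].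
  destruct I as [I|I]; [left|right]; intros A BA; apply I in BA; rewrite <- E; auto.
Qed.

Lemma Ramsey_compl pos (F : family) : Ramsey pos F -> Ramsey pos (fun A => ~ F A).
Proof.
  intros H a n X HX. destruct (H a n X HX) as [Y [HY [RY I]]].
  exists Y; split; [auto|split; [auto|]].
  destruct I as [I|I]; [right|left]; intros A BA; apply I in BA; auto.
Qed.

(** A member of [U] has a cut beyond which every extension stays in [U]; that stem would be
    accepted, so rejection along [Y] means disjointness. *)
Lemma Ramsey_open pos (U : family) : coideal pos -> open2N U -> Ramsey pos U.
Proof.
  intros Hpos HU a n X HX.
  destruct (accept_or_reject pos U a n X Hpos HX) as [Y [HY [RY D]]].
  exists Y; split; [auto|split; [auto|]].
  destruct D as [I|J]; [auto|right]. intros A BA UA.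
  destruct (HU A UA) as [N HN].
  destruct (cut_unbounded n A N) as [m [Hm Cm]]; [apply BA|].
  apply (J A m BA Cm). intros A' BA'. apply HN. intros k Hk. apply BA'. lia.
Qed.

Lemma decides_fusion pos (Fs : nat -> nat -> family) X :
  decr pos X -> (forall i m, Ramsey pos (Fs i m)) ->
  exists Y, decr pos Y /\ refines Y X /\
    forall i m b, i <= m -> included_on b m Y (Fs i m) \/ disjoint_on b m Y (Fs i m).
Proof.
  intros HX HF.
  apply (fusion pos (fun i m b Y => included_on b m Y (Fs i m) \/ disjoint_on b m Y (Fs i m))); auto.
  - intros i m b b' Y E [I|I]; [left|right]; intros A BA; apply I;
    (eapply basic_agree; [|eauto]; intros j Hj; symmetry; auto).
  - intros i m b Y Z S [I|I]; [left|right]; intros A BA; apply I; eapply basic_mono; eauto.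
  - intros i m b Y HY RY. apply HF; auto.
Qed.

(** As for open sets: if [A] lies in [Us i], a cut [m >= i] of [A] gives a stem at which [Us i] is
    already decided, necessarily by inclusion, so this stem accepts the union. *)
Lemma Ramsey_union pos (Us : nat -> family) :
  coideal pos -> (forall i, Ramsey pos (Us i)) -> Ramsey pos (fun A => exists i, Us i A).
Proof.
  intros Hpos HU a n X HX.
  destruct (decides_fusion pos (fun i _ => Us i) X HX) as [X1 [H1 [R1 D1]]]; auto.
  destruct (accept_or_reject pos (fun A => exists i, Us i A) a n X1 Hpos H1) as [Y [HY [RY D]]].
  exists Y; split; auto; split; [eapply refines_trans; eauto|].
  destruct D as [I|J]; auto. right. intros A BA [i Ui].
  destruct (cut_unbounded n A i) as [m [Hm Cm]]; [apply BA|].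
  assert (BA' : basic A m X1 A) by (apply basic_cut with a n; auto; eapply refines_basic; eauto).
  apply (J A m BA Cm). destruct (D1 i m A Hm) as [I|I].
  - intros A' B'. exists i. apply I. eapply refines_basic; eauto.
  - destruct (I A BA' Ui).
Qed.

Lemma Ramsey_inter pos (F G : family) :
  coideal pos -> Ramsey pos F -> Ramsey pos G -> Ramsey pos (fun A => F A /\ G A).
Proof.
  intros Hpos HF HG.
  apply Ramsey_ext with (fun A => ~ exists i : nat, match i with 0 => ~ F A | _ => ~ G A end).
  - intro A. split.
    + intro H. split; apply NNPP; intro C; apply H; [exists 0|exists 1]; auto.
    + intros [? ?] [[|i] ?]; auto.
  - apply Ramsey_compl.
    apply Ramsey_union with (Us := fun i A => match i with 0 => ~ F A | _ => ~ G A end); auto.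
    intros [|i]; apply Ramsey_compl; auto.
Qed.

(** * Codes of finite sequences and the Souslin operation *)

Definition ncode (s : list nat) : nat := fold_left (fun c i => S (to_nat (c, i))) s 0.

(** A child has a larger code than its parent and decodes to the parent's code and the last entry;
    [tree_exists] recurses in this order. *)
Lemma ncode_snoc s i : ncode (s ++ [i]) = S (to_nat (ncode s, i)).
Proof. unfold ncode. rewrite fold_left_app. reflexivity. Qed.

Lemma ncode_inj s t : ncode s = ncode t -> s = t.
Proof.
  revert t. induction s as [|i s IH] using rev_ind; intros t H;
  destruct t as [|j t _] using rev_ind; auto; rewrite ?ncode_snoc in H; try discriminate.
  apply eq_add_S, to_nat_inj in H. injection H as H ->.
  rewrite (IH t H). reflexivity.
Qed.

Lemma ncode_inverse : exists d : nat -> list nat, forall s, d (ncode s) = s.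
Proof.
  destruct (functional_choice (fun k s => forall t, ncode t = k -> t = s)) as [d Hd].
  - intro k. destruct (classic (exists s, ncode s = k)) as [[s Hs]|C].
    + exists s. intros t Ht. apply ncode_inj. congruence.
    + exists []. intros t Ht. destruct C; eauto.
  - exists d. intro s. symmetry. apply (Hd (ncode s)). reflexivity.
Qed.

Lemma prefix_S f n : prefix f (S n) = prefix f n ++ [f n].
Proof. unfold prefix. rewrite seq_S, map_app. reflexivity. Qed.

Lemma prefix_length f n : length (prefix f n) = n.
Proof. unfold prefix. rewrite length_map, length_seq. reflexivity. Qed.

Lemma branch_choice {T : Type} (I : T -> list nat -> Prop) (x0 : T) :
  I x0 [] -> (forall x s, I x s -> exists y i, I y (s ++ [i])) ->
  exists f : nat -> nat, forall n, exists x, I x (prefix f n).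
Proof.
  intros H0 Hs.
  destruct (dependent_choice_inv (fun p : T * list nat => I (fst p) (snd p))
    (fun _ p q => exists i, snd q = snd p ++ [i]) (x0, [])) as [h [h0 Hh]]; auto.
  { intros _ [x s] H. destruct (Hs x s H) as [y [i Hy]]. exists (y, s ++ [i]); simpl; eauto. }
  destruct (functional_choice (fun n i => snd (h (S n)) = snd (h n) ++ [i])) as [f Hf].
  { intro n. apply Hh. }
  exists f. intro n. exists (fst (h n)).
  replace (prefix f n) with (snd (h n)); [apply Hh|].
  induction n; [rewrite h0; reflexivity|]. rewrite prefix_S, Hf. congruence.
Qed.

(** Each [F s], the part of the Souslin set witnessed through [s], gets a Ramsey hull [M m s]. The
    part [N m s] of a hull not covered by the hulls of the children misses [F s], and by maximality
    of the hull it cannot fill a basic set. Avoiding all these gaps, a point of the root hull can be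
    followed up a branch. *)
Lemma Ramsey_souslin pos (S : list nat -> family) :
  coideal pos -> (forall s, Ramsey pos (S s)) -> Ramsey pos (souslin S).
Proof.
  intros Hpos HS a n X HX.
  destruct ncode_inverse as [d Hd].
  set (F := fun s A => exists f, prefix f (length s) = s /\ forall n, S (prefix f (n + 1)) A).
  (* [souslin] evaluates [S] at nonempty sequences only, so the root imposes no condition. *)
  set (S' := fun s A => s = [] \/ S s A).
  assert (FS' : forall s A, F s A -> S' s A).
  { intros s A [f [E H]]. destruct s as [|i s] using rev_ind; [left; auto|right].
    rewrite <- E, length_app. apply H. }
  assert (Fext : forall s A, F s A -> exists i, F (s ++ [i]) A).
  { intros s A [f [E H]]. exists (f (length s)), f. split; auto.
    rewrite length_app, Nat.add_1_r, prefix_S, E. reflexivity. }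
  destruct (decide_included pos (fun i A => ~ F (d i) A) X HX) as [X1 [H1 [R1 D1]]].
  (* the hull of [F s] as seen from the stems *)
  set (M := fun m s A => S' s A /\ forall j, cut m A j -> ncode s <= j ->
                ~ included_on A j X1 (fun A => ~ F s A)).
  assert (FM : forall m s A, basic A m X1 A -> F s A -> M m s A).
  { intros m s A BA FA. split; auto. intros j Cj _ I.
    apply (I A); auto. apply basic_cut with A m; auto. }
  assert (RM : forall m s, Ramsey pos (M m s)).
  { intros m s. apply Ramsey_inter; auto.
    - destruct s as [|i s].
      + apply Ramsey_open; auto. intros x _. exists 0. intros; left; auto.
      + apply Ramsey_ext with (S (i :: s)); auto. intro A. unfold S'.
        split; [auto|intros [?|?]; [discriminate|auto]].
    - apply Ramsey_ext with (fun A => ~ exists j, cut m A j /\ ncode s <= j /\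
                included_on A j X1 (fun A => ~ F s A)).
      + intro A. split; [intros H j Cj Hj I; apply H; eauto|intros H [j [Cj [Hj I]]]].
        apply (H j Cj Hj I).
      + apply Ramsey_compl, Ramsey_open; auto. intros A [j [Cj [Hj I]]].
        exists j. intros A' E. exists j. split; [eapply cut_agree; eauto|split; auto].
        eapply included_agree; eauto. }
  set (N := fun m s A => M m s A /\ ~ exists i, M m (s ++ [i]) A).
  destruct (decides_fusion pos (fun i m => N m (d i)) X1 H1) as [X2 [H2 [R2 D2]]].
  { intros i m. apply Ramsey_inter; auto. apply Ramsey_compl, Ramsey_union; auto. }
  (* If [N m s] filled a basic set of [X2], that set would miss [F s]. Then [X1] could not reject
     the complement of [F s] at this stem, so it would accept it, which membership in [M m s]
     forbids. *)
  assert (Nempty : forall s m b, ncode s <= m -> disjoint_on b m X2 (N m s)).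
  { intros s m b Hs. destruct (D2 (ncode s) m b Hs) as [I|I]; rewrite Hd in I; auto.
    exfalso.
    assert (NF : included_on b m X2 (fun A => ~ F s A)).
    { intros A BA FA. destruct (I A BA) as [_ H]. apply H.
      destruct (Fext s A FA) as [i Fi]. exists i. apply FM; auto.
      apply basic_agree with b; [apply BA|]. eapply refines_basic; eauto. }
    destruct (basic_inhabited (fun _ => True) b m X2) as [A [BA _]].
    { apply H2. }
    { intro j. eapply ninfinite_subset; [|eapply coideal_inf; [exact Hpos|apply H2]].
      intros k Hk; split; eauto. }
    destruct (I A BA) as [[_ MA] _].
    apply (MA m); auto; [constructor|].
    destruct (D1 (ncode s) m A Hs) as [H|H]; rewrite Hd in H; auto.
    exfalso. apply (H X2 H2 R2). eapply included_agree; [|exact NF]. apply BA. }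
  destruct (RM n [] a n X2 H2) as [Y [HY [RY D]]].
  assert (RYX1 : refines Y X1) by (eapply refines_trans; eauto).
  exists Y. split; [auto|split; [eapply refines_trans; eauto|]].
  destruct D as [I|I]; [left|right].
  - intros A BA.
    assert (IA : ninfinite A) by apply BA.
    (* The state [m] is a cut of [A], moved beyond [ncode s] before each step so that [Nempty]
       applies. *)
    destruct (branch_choice (fun m s => cut n A m /\ M m s A) n) as [f Hf].
    + split; [constructor|auto].
    + intros m s [Cm Mm].
      destruct (cut_unbounded m A (ncode s) IA) as [m' [Hm' Cm']].
      assert (C' : cut n A m') by (eapply cut_trans; eauto).
      exists m'. assert (M' : M m' s A).
      { split; [apply Mm|]. intros j Cj. apply Mm. eapply cut_trans; eauto. }
      assert (H : ~ N m' s A).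
      { apply (Nempty s m' A Hm'). apply basic_cut with a n; auto.
        eapply refines_basic; eauto. }
      apply NNPP; intro C. apply H. split; auto.
      intros [i Mi]. apply C. eauto.
    + exists f. intro k. destruct (Hf (k + 1)) as [m [_ [[E|H] _]]]; auto.
      apply (f_equal (@length nat)) in E. rewrite prefix_length in E. simpl in E. lia.
  - intros A BA [f Hf]. apply (I A BA). apply FM.
    + apply basic_agree with a; [apply BA|]. eapply refines_basic; eauto.
    + exists f. split; auto.
Qed.

Lemma Ramsey_Cmeasurable pos F : coideal pos -> Cmeasurable F -> Ramsey pos F.
Proof.
  intros Hpos HF. apply HF.
  - intros U. apply Ramsey_open; auto.
  - intros U. apply Ramsey_compl.
  - intros Us. apply Ramsey_union; auto.
  - intros S. apply Ramsey_souslin; auto.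
Qed.

(** * Families generated by countably many sets orthogonal to a given family *)

(* Unlike [ctbl_generated_in _ (perpf B)], generators may be finite; this makes the notion
   stable under the operations below. *)
Definition small (B F : family) : Prop :=
  exists Ds : nat -> nset, (forall n b, B b -> perp (Ds n) b) /\
    forall A, F A -> exists n, almost_sub A (Ds n).

Definition restrict (F : family) (X : nset) : family := fun A => F A /\ subset A X.

Lemma small_mono B (F G : family) : (forall A, F A -> G A) -> small B G -> small B F.
Proof. intros S [Ds [H K]]. exists Ds. auto. Qed.

Lemma small_union B (Fs : nat -> family) :
  (forall n, small B (Fs n)) -> small B (fun A => exists n, Fs n A).
Proof.
  intro H. destruct (functional_choice _ H) as [D HD].
  exists (fun p => D (fst (of_nat p)) (snd (of_nat p))). split.
  - intros p b Bb. apply HD; auto.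
  - intros A [n FA]. destruct (HD n) as [_ K]. destruct (K A FA) as [m Hm].
    exists (to_nat (n, m)). rewrite cancel_of_to. exact Hm.
Qed.

(** A generator that almost contains an infinite set is itself infinite, so finite generators are
    never the ones used. *)
Lemma small_ctbl_generated (B F : family) :
  in_Pinf F -> small B F -> ctbl_generated_in F (perpf B).
Proof.
  intros HF [Ds [H K]]. exists Ds. intros A FA. destruct (K A FA) as [n Hn].
  exists n. split; [split|auto].
  - eapply ninfinite_subset; [|apply ninfinite_almost_sub; [apply HF, FA|exact Hn]].
    intros k [_ ?]; auto.
  - intros b Bb. auto.
Qed.

Lemma nfinite_union (X Y Z : nset) :
  (forall k, Z k -> X k \/ Y k) -> nfinite X -> nfinite Y -> nfinite Z.
Proof.
  intros H [N HN] [M HM]. exists (N + M). intros k Hk.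
  destruct (H k Hk) as [h|h]; [apply HN in h|apply HM in h]; lia.
Qed.

Lemma nfinite_subset (X Y : nset) : subset X Y -> nfinite Y -> nfinite X.
Proof. intros S [N HN]. exists N. auto. Qed.

Lemma positive_coideal (B F : family) :
  hereditary F -> coideal (fun X => ~ small B (restrict F X)).
Proof.
  intros [Finf Fher]. split.
  - intros X Y S H K. apply H. apply small_mono with (restrict F Y); auto.
    intros A [FA SA]. split; auto. intros k h. auto.
  - intros X P H. apply NNPP; intro C. apply not_or_and in C. destruct C as [C1 C2].
    apply NNPP in C1, C2. apply H. destruct C1 as [D [HD KD]], C2 as [E [HE KE]].
    (* Unions of one generator for each half; heredity puts the infinite ones among the two pieces
       of [A] back into [F]. *)
    exists (fun p k => D (fst (of_nat p)) k \/ E (snd (of_nat p)) k). split.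
    + intros p b Bb. eapply nfinite_union; [|apply (HD (fst (of_nat p)) b Bb)|apply (HE (snd (of_nat p)) b Bb)].
      simpl. tauto.
    + intros A [FA SA].
      (* a finite piece of [A] is almost contained in anything *)
      assert (piece : forall (Q : nset) (D : nat -> nset),
        (forall A, restrict F (fun k => X k /\ Q k) A -> exists n, almost_sub A (D n)) ->
        exists n, almost_sub (fun k => A k /\ Q k) (D n)).
      { intros Q D' K. destruct (classic (nfinite (fun k => A k /\ Q k))) as [h|h].
        - exists 0. eapply nfinite_subset; [|exact h]. intros k [? _]; auto.
        - apply K. split.
          + apply Fher with A; [auto|apply not_nfinite; auto|intros k [? _]; auto].
          + intros k [Ak Qk]. auto. }
      destruct (piece P D KD) as [n Hn]. destruct (piece (fun k => ~ P k) E KE) as [m Hm].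
      exists (to_nat (n, m)). rewrite cancel_of_to. simpl.
      eapply nfinite_union; [|exact Hn|exact Hm].
      intros k [Ak Hk]. simpl. destruct (classic (P k)); tauto.
  - intros X H. apply not_nfinite. intro C. apply H. exists (fun _ _ => False). split.
    + intros _ b _. exists 0. intros k [[] _].
    + intros A [FA SA]. exfalso. apply (ninfinite_not_nfinite A); [auto|].
      eapply nfinite_subset; eauto.
Qed.

(** Otherwise [X] is orthogonal to [B] and is by itself a generator. *)
Lemma positive_contains (B F : family) X :
  hereditary B -> ~ small B (restrict F X) -> exists b, B b /\ subset b X.
Proof.
  intros [_ Bher] H. apply NNPP; intro C. apply H. exists (fun _ => X). split.
  - intros _ b Bb. apply NNPP; intro I. apply C. exists (fun k => X k /\ b k). split.
    + apply Bher with b; [auto|apply not_nfinite; auto|intros k [_ ?]; auto].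
    + intros k [? _]; auto.
  - intros A [_ SA]. exists 0, 0. intros k [Ak NX]. destruct NX; auto.
Qed.

Definition pseudo_intersections_meet (B : family) (X : nat -> nset) : Prop :=
  forall A, ninfinite A -> (forall n, almost_sub A (X n)) -> exists b, B b /\ subset b A.

(* The Ramsey property of [B], the M-property excluding the homogeneous sequences that avoid [B]. *)
Lemma positive_sequence (B F : family) Z :
  Cmeasurable B -> Mfamily B -> hereditary F -> ~ small B (restrict F Z) ->
  exists X, decr (fun X => ~ small B (restrict F X)) X /\
    (forall n, subset (X n) Z) /\ pseudo_intersections_meet B X.
Proof.
  intros HC [HB HM] HF HZ.
  assert (Hpos := positive_coideal B F HF).
  destruct (Ramsey_Cmeasurable _ B Hpos HC (fun _ => False) 0 (fun _ => Z)) as [Y [HY [RY D]]].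
  { split; [intros i j _ k; auto|auto]. }
  assert (thin : forall A, ninfinite A -> (forall n, almost_sub A (Y n)) ->
    exists A', basic (fun _ => False) 0 Y A' /\ subset A' A).
  { intros A IA SA.
    destruct (basic_inhabited A (fun _ => False) 0 Y) as [A' [BA' SA']]; [apply HY| |].
    - intro j. eapply ninfinite_subset; [|apply ninfinite_almost_sub; [exact IA|apply (SA j)]].
      intros k [? ?]; auto.
    - exists A'. split; auto. intros k. apply SA'. lia. }
  exists Y. split; [auto|split; [auto|]]. destruct D as [I|I].
  - intros A IA SA. destruct (thin A IA SA) as [A' [BA' SA']]. eauto.
  - exfalso.
    (* The M-property turns members of [B] inside the [Y n] into one member almost contained in
       every [Y n]; thinning it gives a member of [B] in the basic set. *)
    destruct (functional_choice (fun n b => B b /\ subset b (Y n))) as [b Hb].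
    { intro n. apply positive_contains with F; auto. apply HY. }
    destruct (HM b) as [A [BA SA]]; [apply Hb|].
    assert (IA : ninfinite A) by (apply HB; auto).
    destruct (thin A IA) as [A' [BA' SA']].
    + intro n. eapply nfinite_subset; [|apply (SA n)].
      intros k [Ak NY]. split; auto. intros [i [Hi bk]]. apply NY.
      apply (proj1 HY n i Hi). apply Hb; auto.
    + apply (I A' BA'). apply HB with A; auto. apply BA'.
Qed.

(** * The tree of regions *)

(** [val] is the value of [psi]; [sig] below [dep] is the determined part of a point of Baire space;
    [pts] contains the values along the branch so far; [reg i] will hold the values of the [i]-th
    child and all its descendants. *)
Record node : Type := Node {
  val : nat;
  dep : nat;
  sig : nat -> nat;
  pts : nset;
  reg : nat -> nset }.

Section Tree.

Context (B : family) (g : (nat -> nat) -> nset).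

(* The part of the hereditary closure of the range of [g] lying over the stem [(d, s)] and
   through the points [P]. *)
Definition cone (d : nat) (s : nat -> nat) (P : nset) : family := fun A =>
  ninfinite A /\ exists f, (forall j, j < d -> f j = s j) /\ subset P (g f) /\ subset A (g f).

Definition valid (x : node) : Prop :=
  decr (fun X => ~ small B (restrict (cone (dep x) (sig x) (pts x)) X)) (reg x) /\
  pseudo_intersections_meet B (reg x).

Definition child (y : node) (i : nat) (x : node) : Prop :=
  valid x /\ reg y i (val x) /\ (forall j, subset (reg x j) (reg y i)) /\
  dep x = S (dep y) /\ (forall j, j < dep y -> sig x j = sig y j) /\
  subset (pts y) (pts x) /\ pts x (val x).

Lemma cone_hereditary d s P : hereditary (cone d s P).
Proof.
  split; [intros A H; apply H|]. intros A A' [_ [f [E [SP SA]]]] I S.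
  split; auto. exists f. repeat split; auto. intros k h; auto.
Qed.

(** Each member of the cone inside [reg y i] has an element [k >= N], and its witness [f] has some
    value [v] at [dep y]. This splits the cone into countably many pieces; they cannot all be small,
    and a piece that is not small gives the child. *)
Lemma child_exists y i N :
  Cmeasurable B -> Mfamily B -> valid y -> exists x, child y i x /\ N <= val x.
Proof.
  intros HC HM [Hy _].
  set (s' := fun v j => if j =? dep y then v else sig y j).
  set (P' := fun k j => pts y j \/ j = k).
  destruct (classic (exists k v, N <= k /\ reg y i k /\
     ~ small B (restrict (cone (S (dep y)) (s' v) (P' k)) (reg y i)))) as [[k [v [Hk [Rk Hs]]]]|C].
  - destruct (positive_sequence B _ _ HC HM (cone_hereditary _ _ _) Hs) as [X [HX [SX MX]]].
    exists (Node k (S (dep y)) (s' v) (P' k) X). split; [|auto].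
    split; [split; auto|]. simpl. repeat split; auto.
    + intros j Hj. unfold s'. destruct (Nat.eqb_spec j (dep y)); [lia|auto].
    + intros j h. left; auto.
    + right; auto.
  - exfalso. apply (proj2 Hy i).
    apply small_mono with (fun A => exists p, (N <= fst (of_nat p) /\ reg y i (fst (of_nat p))) /\
      restrict (cone (S (dep y)) (s' (snd (of_nat p))) (P' (fst (of_nat p)))) (reg y i) A).
    + intros A [[IA [f [E [SP SA]]]] RA]. destruct (IA N) as [k [Hk Ak]].
      exists (to_nat (k, f (dep y))). rewrite cancel_of_to. simpl.
      repeat split; auto. exists f. repeat split; auto.
      * intros j Hj. unfold s'. destruct (Nat.eqb_spec j (dep y)) as [->|]; [auto|].
        apply E; lia.
      * intros j [h| ->]; auto.
    + apply small_union. intro p.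
      destruct (classic (N <= fst (of_nat p) /\ reg y i (fst (of_nat p)))) as [H|H].
      * apply small_mono with (restrict (cone (S (dep y)) (s' (snd (of_nat p)))
          (P' (fst (of_nat p)))) (reg y i)); [tauto|].
        apply NNPP; intro K. apply C. exists (fst (of_nat p)), (snd (of_nat p)). tauto.
      * exists (fun _ _ => False). split; [intros _ b _; exists 0; intros k [[] _]|tauto].
Qed.

Lemma tree_exists :
  Cmeasurable B -> Mfamily B -> ~ small B (cone 0 (fun _ => 0) (fun _ => False)) ->
  exists (x0 : node) (F : list nat -> node),
    dep x0 = 0 /\ child x0 0 (F []) /\
    (forall t i, child (F t) i (F (t ++ [i]))) /\
    (forall s t, val (F s) = val (F t) -> s = t).
Proof.
  intros HC HM Hs.
  destruct (positive_sequence B (cone 0 (fun _ => 0) (fun _ => False)) (fun _ => True))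
    as [X [HX [_ MX]]]; auto.
  { apply cone_hereditary. }
  { intro K. apply Hs. eapply small_mono; [|exact K]. intros A h. split; auto. intros k _; exact I. }
  set (x0 := Node 0 0 (fun _ => 0) (fun _ => False) X).
  assert (V0 : valid x0) by (split; auto).
  set (par := fun n (h : nat -> node) => match n with 0 => x0 | S m => h (fst (of_nat m)) end).
  set (idx := fun n => match n with 0 => 0 | S m => snd (of_nat m) end).
  assert (lt_par : forall m, fst (of_nat m) < S m).
  { intro m. pose proof (to_nat_non_decreasing (fst (of_nat m)) (snd (of_nat m))) as L.
    rewrite <- surjective_pairing, cancel_to_of in L. lia. }
  (* Values increase strictly with the codes, which yields injectivity. *)
  destruct (strong_choice x0 (fun n h x => child (par n h) (idx n) x /\
     forall m, m < n -> val (h m) < val x)) as [F HF].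
  - intros n h h' x E [Hc Hv]. split.
    + destruct n as [|m]; simpl in *; auto. rewrite <- E; auto.
    + intros m Hm. rewrite <- E; auto.
  - intros n h Hh.
    assert (exists N, forall m, m < n -> val (h m) < N) as [N HN].
    { clear Hh. induction n as [|n [N HN]]; [exists 0; lia|].
      exists (N + S (val (h n))). intros m Hm. destruct (Nat.eq_dec m n) as [->|]; [lia|].
      assert (val (h m) < N) by (apply HN; lia). lia. }
    destruct (child_exists (par n h) (idx n) N) as [x [Hx Lx]]; auto.
    { destruct n as [|m]; simpl; auto. apply (Hh (fst (of_nat m))); auto. }
    exists x. split; auto. intros m Hm. apply HN in Hm. lia.
  - exists x0, (fun t => F (ncode t)). split; [auto|split; [|split]].
    + apply (HF 0).
    + intros t i. destruct (HF (ncode (t ++ [i]))) as [Hc _].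
      rewrite ncode_snoc in Hc |- *. unfold par, idx in Hc.
      rewrite cancel_of_to in Hc. exact Hc.
    + intros s t E. apply ncode_inj.
      destruct (Nat.lt_trichotomy (ncode s) (ncode t)) as [L|[L|L]]; auto;
      apply HF in L; lia.
Qed.

End Tree.

(** * Values along branches and inside subtrees *)

Section Branches.

Context (B : family) (g : (nat -> nat) -> nset) (x0 : node) (F : list nat -> node).
Hypothesis Hx0 : dep x0 = 0.
Hypothesis Hroot : child B g x0 0 (F []).
Hypothesis Hchild : forall t i, child B g (F t) i (F (t ++ [i])).

Lemma tree_valid t : valid B g (F t).
Proof. destruct t as [|i t _] using rev_ind; [apply Hroot|apply Hchild]. Qed.

Lemma tree_dep t : dep (F t) = S (length t).
Proof.
  induction t as [|i t IH] using rev_ind.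
  - destruct Hroot as [_ [_ [_ [E _]]]]. rewrite E, Hx0. reflexivity.
  - destruct (Hchild t i) as [_ [_ [_ [E _]]]]. rewrite E, IH, length_app. simpl. lia.
Qed.

Lemma tree_pts_self t : pts (F t) (val (F t)).
Proof. destruct t as [|i t _] using rev_ind; [apply Hroot|apply Hchild]. Qed.

Lemma tree_pts t u : subset (pts (F t)) (pts (F (t ++ u))).
Proof.
  induction u as [|i u IH] using rev_ind; [rewrite app_nil_r; intros k h; auto|].
  rewrite app_assoc. intros k h. apply Hchild. auto.
Qed.

Lemma tree_sig t u j : j <= length t -> sig (F (t ++ u)) j = sig (F t) j.
Proof.
  intro Hj. induction u as [|i u IH] using rev_ind; [rewrite app_nil_r; auto|].
  rewrite app_assoc, <- IH. apply Hchild. rewrite tree_dep, length_app. lia.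
Qed.

Lemma tree_reg t i u :
  reg (F t) i (val (F (t ++ i :: u))) /\ forall j, subset (reg (F (t ++ i :: u)) j) (reg (F t) i).
Proof.
  induction u as [|l u [_ IH]] using rev_ind.
  - split; apply Hchild.
  - replace (t ++ i :: u ++ [l]) with ((t ++ i :: u) ++ [l]) by (rewrite <- app_assoc; auto).
    split; [apply (IH l), Hchild|]. intros j k h. apply (IH l).
    destruct (Hchild (t ++ i :: u) l) as [_ [_ [S _]]]. eapply S; eauto.
Qed.

Lemma prefix_app f n m : n <= m -> exists u, prefix f m = prefix f n ++ u.
Proof.
  induction 1 as [|m _ [u E]]; [exists []; rewrite app_nil_r; auto|].
  exists (u ++ [f m]). rewrite prefix_S, E, app_assoc. reflexivity.
Qed.

(** The node at depth [j] has fixed coordinate [j], so the branch defines [h]. By continuity only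
    [m] coordinates of [h] matter for whether [k] belongs to [g h]. A node deep enough to fix these
    and to have [k] among its points has a nonempty cone, and any witness there agrees with [h] far
    enough. *)
Lemma tree_branch (f : nat -> nat) :
  continuous_BC g -> exists h, forall n, g h (val (F (prefix f n))).
Proof.
  intro Hg. set (h := fun j => sig (F (prefix f j)) j). exists h. intro n.
  set (k := val (F (prefix f n))).
  destruct (Hg h (S k)) as [m Hm].
  destruct (prefix_app f n (n + m)) as [u Eu]; [lia|].
  destruct (tree_valid (prefix f (n + m))) as [[_ V] _].
  assert (exists A, cone g (dep (F (prefix f (n + m)))) (sig (F (prefix f (n + m))))
      (pts (F (prefix f (n + m)))) A) as [A [_ [f' [Ef [Pf _]]]]].
  { apply NNPP; intro C. apply (V 0). exists (fun _ _ => False). split.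
    - intros _ b _. exists 0. intros j [[] _].
    - intros A [HA _]. destruct C; eauto. }
  assert (E : forall j, j < m -> f' j = h j).
  { intros j Hj. rewrite Ef; [|rewrite tree_dep, prefix_length; lia].
    destruct (prefix_app f j (n + m)) as [w Ew]; [lia|].
    rewrite Ew. apply tree_sig. rewrite prefix_length. lia. }
  apply (Hm f' E k); [lia|]. apply Pf. rewrite Eu. apply tree_pts, tree_pts_self.
Qed.

End Branches.

(** * Chains and well-founded trees *)

Lemma injective_bounded_finite (W : tset) (mu : list nat -> nat) N :
  (forall s t, W s -> W t -> mu s = mu t -> s = t) ->
  exists l, forall s, W s -> mu s < N -> In s l.
Proof.
  intro Inj. induction N as [|N [l Hl]]; [exists []; lia|].
  destruct (classic (exists s, W s /\ mu s = N)) as [[s [Ws Es]]|C].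
  - exists (s :: l). intros t Wt Ht. destruct (Nat.eq_dec (mu t) N).
    + left. apply Inj; auto. congruence.
    + right. apply Hl; auto. lia.
  - exists l. intros t Wt Ht. destruct (Nat.eq_dec (mu t) N); [destruct C; eauto|].
    apply Hl; auto. lia.
Qed.

Lemma injective_image_infinite (W : tset) (mu : list nat -> nat) :
  (forall s t, W s -> W t -> mu s = mu t -> s = t) -> tinfinite W ->
  ninfinite (fun k => exists s, W s /\ k = mu s).
Proof.
  intros Inj HW. apply not_nfinite. intros [N HN]. apply HW.
  destruct (injective_bounded_finite W mu N Inj) as [l Hl].
  exists l. intros s Ws. apply Hl; eauto.
Qed.

Lemma endext_length_eq s t : endext s t -> length s = length t -> s = t.
Proof.
  intros [u ->] E. rewrite length_app in E. destruct u; [|simpl in E; lia].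
  symmetry; apply app_nil_r.
Qed.

Lemma endext_nth s t j : endext s t -> j < length s -> nth j s 0 = nth j t 0.
Proof. intros [u ->] Hj. rewrite app_nth1; auto. Qed.

Lemma prefix_nth s f : (forall j, j < length s -> nth j s 0 = f j) -> s = prefix f (length s).
Proof.
  intro H. apply nth_ext with 0 (f 0); [rewrite prefix_length; auto|].
  intros j Hj. unfold prefix. rewrite map_nth, seq_nth, H; auto.
Qed.

(** Comparable sequences of equal length coincide, so lengths in the chain are unbounded and each
    coordinate can be read off a long enough member. *)
Lemma chain_branch (C : tset) : chainsC C -> exists f, forall s, C s -> s = prefix f (length s).
Proof.
  intros [IC Comp].
  assert (L := injective_image_infinite C (@length nat)).
  destruct (functional_choice (fun j s => C s /\ j < length s)) as [c Hc].
  { intro j. destruct L with (N := S j) as [k [Hk [s [Cs ->]]]]; eauto.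
    intros s t Cs Ct E. destruct (Comp s t Cs Ct); [|symmetry]; apply endext_length_eq; auto. }
  exists (fun j => nth j (c j) 0). intros s Cs. apply prefix_nth. intros j Hj.
  destruct (Hc j) as [Cc Lc].
  destruct (Comp s (c j) Cs Cc); [|symmetry]; apply endext_nth; auto.
Qed.

Lemma tinfinite_subset (W V : tset) : (forall s, W s -> V s) -> tinfinite W -> tinfinite V.
Proof. intros S H [l Hl]. apply H. exists l. auto. Qed.

Lemma tfinite_union_lt (W : nat -> tset) n :
  (forall i, tfinite (W i)) -> tfinite (fun s => exists i, i < n /\ W i s).
Proof.
  intro H. induction n as [|n [l Hl]]; [exists []; intros s [i [? _]]; lia|].
  destruct (H n) as [l' Hl']. exists (l ++ l'). intros s [i [Hi Ws]].
  apply in_or_app. destruct (Nat.eq_dec i n) as [->|]; [right; auto|left].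
  apply Hl. exists i. split; [lia|auto].
Qed.

(** Otherwise one can climb forever through nodes with infinitely many elements of [Y] above them;
    all these nodes lie in [T] by downward closure. *)
Lemma wf_finite_above_successors (T Y : tset) :
  WF T -> (forall s, Y s -> T s) -> tinfinite Y ->
  exists t, tinfinite (fun s => Y s /\ endext t s) /\
    forall i, tfinite (fun s => Y s /\ endext (t ++ [i]) s).
Proof.
  intros [Tdown [Twf _]] YT IY. apply NNPP; intro C.
  destruct (branch_choice (fun (_ : unit) t => tinfinite (fun s => Y s /\ endext t s)) tt) as [f Hf].
  - eapply tinfinite_subset; [|exact IY]. intros s Ys. split; auto. exists s; auto.
  - intros _ t It. exists tt. apply NNPP; intro D. apply C. exists t. split; auto.
    intro i. apply NNPP; intro E. apply D. exists i; auto.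
  - apply Twf. exists f. intro n. destruct (Hf n) as [_ In].
    apply NNPP; intro D. apply In. exists []. intros s [Ys E]. apply D.
    apply (Tdown s); auto.
Qed.

(** If some [D] in [perpf B] met the image in an infinite set, the nodes responsible would produce,
    above a suitable [t], a member of [B] contained in [D]. *)
Lemma wf_image_perpperp (B : family) g x0 (F : list nat -> node) (W : tset) :
  dep x0 = 0 -> child B g x0 0 (F []) -> (forall t i, child B g (F t) i (F (t ++ [i]))) ->
  (forall s t, val (F s) = val (F t) -> s = t) -> hereditary B -> Iwf W ->
  perpf (perpf B) (fun k => exists s, W s /\ k = val (F s)).
Proof.
  intros H0 Hroot Hchild Inj [Binf _] [IW [T [HT WT]]]. split.
  { apply injective_image_infinite with (mu := fun s => val (F s)); auto. }
  intros D [ID HD]. apply NNPP; intro Inf. apply not_nfinite in Inf.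
  set (Y := fun s => W s /\ D (val (F s))).
  assert (IY : tinfinite Y).
  { intros [l Hl]. apply (ninfinite_not_nfinite _ Inf).
    exists (S (list_max (map (fun s => val (F s)) l))). intros k [[s [Ws ->]] Dk].
    assert (In s l) as I by (apply Hl; split; auto).
    apply (in_map (fun s => val (F s))) in I.
    pose proof (proj1 (list_max_le (map (fun s => val (F s)) l) _) (Nat.le_refl _)) as L.
    rewrite Forall_forall in L. apply L in I. lia. }
  destruct (wf_finite_above_successors T Y HT) as [t [It Ft]]; auto.
  { intros s [Ws _]; auto. }
  (* The node [t] is dropped because only its proper descendants take values in its regions. *)
  set (Y' := fun s => (Y s /\ endext t s) /\ s <> t).
  set (A := fun k => exists s, Y' s /\ k = val (F s)).
  destruct (tree_valid B g x0 F Hroot Hchild t) as [[Dec _] Meet].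
  destruct (Meet A) as [b [Bb Sb]].
  - apply injective_image_infinite with (mu := fun s => val (F s)); auto.
    intros [l Hl]. apply It. exists (t :: l). intros s Hs.
    destruct (classic (s = t)) as [->|]; [left; auto|right; apply Hl; split; auto].
  (* Only finitely many nodes lie above children [i < n]; the others have values in [reg (F t) i]
     with [n <= i], hence in [reg (F t) n]. *)
  - intro n. destruct (tfinite_union_lt _ n Ft) as [l Hl].
    exists (S (list_max (map (fun s => val (F s)) l))). intros k [[s [[[Ys [u ->]] Hne] ->]] Nk].
    destruct u as [|i u]; [destruct Hne; apply app_nil_r|].
    destruct (tree_reg B g F Hchild t i u) as [Ri _].
    destruct (Nat.lt_ge_cases i n) as [Hi|Hi].
    + assert (I : In (t ++ i :: u) l).
      { apply Hl. exists i. split; [auto|split; [auto|]]. exists u. rewrite <- app_assoc. auto. }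
      apply (in_map (fun s => val (F s))) in I.
      pose proof (proj1 (list_max_le (map (fun s => val (F s)) l) _) (Nat.le_refl _)) as L.
      rewrite Forall_forall in L. apply L in I. lia.
    + destruct Nk. apply (Dec n i Hi). auto.
  - apply (ninfinite_not_nfinite b); auto.
    eapply nfinite_subset; [|apply (HD b Bb)].
    intros k bk. split; auto. destruct (Sb k bk) as [s [[[[_ Ds] _] _] ->]]. auto.
Qed.

Theorem mainTheorem2 (A B : family) :
  hereditary A -> hereditary B -> fperp A B ->
  analytic A -> Cmeasurable B -> Mfamily B ->
  ctbl_generated_in A (perpf B) \/
  exists psi : list nat -> nat,
    (forall s t, psi s = psi t -> s = t) /\
    (forall C, chainsC C -> preimages psi A C) /\
    (forall W, Iwf W -> preimages psi (perpf (perpf B)) W).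
Proof.
  intros HA HB _ HAn HC HM.
  destruct HAn as [Emp|[g [Hg HgA]]].
  { left. exists (fun _ _ => True). intros X AX. destruct (Emp X AX). }
  destruct (classic (small B A)) as [Hs|Hs].
  { left. apply small_ctbl_generated; auto. apply HA. }
  right.
  destruct (tree_exists B g HC HM) as [x0 [F [H0 [Hroot [Hchild Inj]]]]].
  { intro K. apply Hs. eapply small_mono; [|exact K]. intros X AX. split; [apply HA, AX|].
    apply HgA in AX. destruct AX as [f Hf]. exists f.
    split; [lia|split; [intros k []|]]. intros k Xk. apply Hf; auto. }
  (* By injectivity each [W] is the preimage of its own image, so the images serve as witnesses
     below. *)
  assert (pre : forall W : tset, forall s, W s <-> exists t, W t /\ val (F s) = val (F t)).
  { intros W s. split; [eauto|]. intros [t [Wt E]]. apply Inj in E. congruence. }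
  exists (fun s => val (F s)). split; [auto|split].
  - intros C HCh. exists (fun k => exists s, C s /\ k = val (F s)). split; [|apply pre].
    destruct (chain_branch C HCh) as [f Hf].
    destruct (tree_branch B g x0 F H0 Hroot Hchild f Hg) as [h Hh].
    destruct HA as [_ Aher]. apply Aher with (g h).
    + apply HgA. exists h. tauto.
    + apply injective_image_infinite with (mu := fun s => val (F s)); auto. apply HCh.
    + intros k [s [Cs ->]]. rewrite (Hf s Cs). apply Hh.
  - intros W HW. exists (fun k => exists s, W s /\ k = val (F s)). split; [|apply pre].
    eapply wf_image_perpperp; eauto.
Qed.
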